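(* Let $1\le p\le\infty$ and let $(X_i)_{i\in I}$ be a non-empty family of real Banach spaces, with $\ell_p$-sum $Z=\ell_p\text{-}\bigoplus_{i\in I}X_i$. (a) If every $X_i$ has the diameter 2 property, then $Z$ has the diameter 2 property. (b) If every $X_i$ has the local diameter 2 property, then $Z$ has the local diameter 2 property.
   Context: All Banach spaces are real. For a Banach space $X$, $B_X$ is the closed unit ball, $X^*$ the dual, $S_{X^*}$ the unit sphere of $X^*$. A slice of $B_X$ is a set $S(x^*,\varepsilon)=\{x\in B_X: x^*(x)>1-\varepsilon\}$ with $x^*\in S_{X^*}$ and $\varepsilon>0$. $X$ has the local diameter 2 property if every slice of $B_X$ has diameter 2; $X$ has the diameter 2 property if every non-empty relatively weakly open subset of $B_X$ has diameter 2. The $\ell_p$-sum of $(X_i)_{i\in I}$ is the space of all $(x_i)_{i\in I}\in\prod_i X_i$ with finite norm $\left(\sum_i\|x_i\|^p\right)^{1/p}$ if $p<\infty$, and $\sup_i\|x_i\|$ if $p=\infty$. *)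

(* Defs.v *)
From HB Require Import structures.
From mathcomp Require Import all_boot all_order all_algebra finmap.
From mathcomp Require Import ring.
From mathcomp Require Import all_classical all_reals all_analysis.
Import Order.TTheory GRing.Theory Num.Theory.
Import numFieldNormedType.Exports.

Set Implicit Arguments.
Unset Strict Implicit.
Unset Printing Implicit Defensive.

Local Open Scope classical_set_scope.
Local Open Scope ring_scope.

Section geometry.
Context {R : realType}.
Implicit Type X : normedModType R.

Definition diam X (A : set X) : \bar R :=
  ereal_sup [set `|x - y|%:E | x in A & y in A].

Definition unit_ball X : set X := [set x | `|x| <= 1].
#[global] Arguments unit_ball X : clear implicits.

Definition dual X : Type := {f : {linear X -> R^o} | continuous f}.

Definition dual_fun X (f : dual X) : X -> R := sval f.
Coercion dual_fun : dual >-> Funclass.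

Definition dual_norm X (f : dual X) : \bar R :=
  ereal_sup [set `|f x|%:E | x in unit_ball X].

Definition dual_sphere X : set (dual X) := [set f | dual_norm f = 1%E].

(* A copy of X carrying the coarsest topology that makes all the elements of
   the dual continuous. *)
Definition weak X : Type :=
  @sup_topology X (dual X)
    (fun f => Topological.class (initial_topology (f : X -> R^o))).

HB.instance Definition _ X := Topological.copy (weak X)
  (@sup_topology X (dual X)
    (fun f => Topological.class (initial_topology (f : X -> R^o)))).

Definition weakly_open X (U : set X) : Prop := @open (weak X) U.

Definition slice X (f : dual X) (e : R) : set X :=
  [set x | unit_ball X x /\ f x > 1 - e].

Definition local_diameter2 X : Prop :=
  forall (f : dual X) (e : R), dual_sphere f -> 0 < e ->
    diam (slice f e) = 2%:E.

Definition diameter2 X : Prop :=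
  forall U : set X, weakly_open U -> (U `&` unit_ball X) !=set0 ->
    diam (U `&` unit_ball X) = 2%:E.

End geometry.

Section lp_sum_def.
Context {R : realType} (p : \bar R) {I : choiceType}.
Variable X : I -> completeNormedModType R.
Implicit Type x : forall i, X i.

Definition lp_norm x : \bar R :=
  match p with
  | r%:E => ((\esum_(i in [set: I]) (`|x i| `^ r)%:E) `^ r^-1)%E
  | +oo%E => ereal_sup [set `|x i|%:E | i in [set: I]]
  | -oo%E => 0%E
  end.

(* The proof of 1 <= p is a parameter, as in the library's [LspaceType], so
   that the normed space structure below can be inferred. *)
Record lp_sum (p1 : (1 <= p)%E) : Type := LpSum {
  lp_coord :> forall i, X i;
  lp_fin : (lp_norm lp_coord < +oo)%E }.

End lp_sum_def.

Section powR_sum.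
Context {R : realType} {I : choiceType}.
Implicit Types (s : seq I) (u v : I -> R) (a b c r : R).

Lemma powR_sum_triangle s u v a b r : 1 <= r -> 0 < a -> 0 < b ->
  (forall i, 0 <= u i) -> (forall i, 0 <= v i) ->
  \sum_(i <- s) u i `^ r <= a `^ r -> \sum_(i <- s) v i `^ r <= b `^ r ->
  \sum_(i <- s) (u i + v i) `^ r <= (a + b) `^ r.
Proof.
move=> r1 a0 b0 u0 v0 su sv.
have ab0 : 0 < a + b by exact: addr_gt0.
have ab_neq0 : a + b != 0 by rewrite gt_eqF.
have t0 : 0 <= a / (a + b) by rewrite divr_ge0// ltW.
have t1 : a / (a + b) <= 1 by rewrite ler_pdivrMr// mul1r lerDl ltW.
have tE : 1 - a / (a + b) = b / (a + b) by field.
have conv i : (u i + v i) `^ r <= (a + b) `^ r *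
    (a / (a + b) * (u i `^ r / a `^ r) + b / (a + b) * (v i `^ r / b `^ r)).
  have -> : u i + v i =
      (a + b) * (a / (a + b) * (u i / a) + b / (a + b) * (v i / b)).
    by field; rewrite ab_neq0 !gt_eqF.
  rewrite powRM ?(ltW ab0)//; last first.
    by rewrite addr_ge0// mulr_ge0// divr_ge0// ltW.
  rewrite ler_wpM2l ?powR_ge0//.
  have := @convex_powR R r r1 (Itv01 t0 t1) (u i / a) (v i / b).
  rewrite !convRE !inE /= !in_itv/= !andbT !divr_ge0 ?(ltW a0) ?(ltW b0)// => /(_ isT isT).
  rewrite [conv _ _ _]convRE /= /unstable.onem tE => /le_trans; apply.
  rewrite !powRM ?invr_ge0 ?(ltW a0) ?(ltW b0)//.
  rewrite -(powR_inv1 (ltW a0)) -(powR_inv1 (ltW b0)) -!powRrM mulN1r.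
  by rewrite !powRN.
apply: (le_trans (ler_sum _ (fun i _ => conv i))).
rewrite -mulr_sumr -[leRHS]mulr1 ler_wpM2l ?powR_ge0//.
rewrite big_split/= -!mulr_sumr -!mulr_suml.
rewrite -[leRHS](divff (lt0r_neq0 ab0)) [leRHS]mulrDl.
by apply: lerD; rewrite ler_piMr ?divr_ge0 ?(ltW a0) ?(ltW b0) ?(ltW ab0)//
  ler_pdivrMr ?powR_gt0// mul1r.
Qed.

End powR_sum.

Section lp_le.
Context {R : realType} (p : \bar R) (p1 : (1 <= p)%E) {I : choiceType}.
Variable X : I -> completeNormedModType R.
Implicit Types (x y : forall i, X i) (c : R).

Definition lp_le x c : Prop :=
  match p with
  | r%:E => forall s : {fset I}, \sum_(i <- s) `|x i| `^ r <= c `^ r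
  | _ => forall i, `|x i| <= c
  end.

Lemma lp_normP x c : 0 <= c -> (lp_norm p x <= c%:E)%E <-> lp_le x c.
Proof.
move=> c0; rewrite /lp_norm /lp_le; case: p p1 => [r r1| |//]; last first.
  move=> _; split=> [/ereal_supP h i|h].
    by rewrite -lee_fin; apply: h; exists i.
  by apply/ereal_supP => _ [i _ <-]; rewrite lee_fin.
rewrite lee_fin in r1; have r0 : 0 < r by exact: lt_le_trans r1.
set S := esum _ _.
have S0 : (0 <= S)%E by apply: esum_ge0 => i _; rewrite lee_fin powR_ge0.
have -> : (S `^ r^-1 <= c%:E)%E = (S <= (c `^ r)%:E)%E.
  rewrite -poweR_EFin; apply/idP/idP => h.
    have := @gt0_ler_poweR R r (ltW r0) (S `^ r^-1)%E c%:E.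
    rewrite -poweRrM mulVf ?gt_eqF// poweRe1//; apply => //;
    by rewrite in_itv/= leey ?lee_fin ?poweR_ge0 ?c0.
  have := @gt0_ler_poweR R r^-1 _ S (c%:E `^ r)%E.
  rewrite -poweRrM mulfV ?gt_eqF// poweRe1// ?lee_fin//; apply => //;
  by rewrite ?invr_ge0 ?(ltW r0) ?in_itv/= ?leey ?S0 ?lee_fin ?powR_ge0.
split=> [/ereal_supP h s|h].
  rewrite -lee_fin -sumEFin; apply: h; exists [set` s].
    by split=> //; exact: finite_fset.
  by rewrite fsbig_finite ?set_fsetK//; exact: finite_fset.
apply/ereal_supP => _ [A [fA _] <-].
by rewrite fsbig_finite// sumEFin lee_fin.
Qed.

Lemma lp_le_coord x c i : 0 <= c -> lp_le x c -> `|x i| <= c.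
Proof.
move=> c0; rewrite /lp_le; case: p p1 => [r r1 h| |//]; last by move=> _ h.
rewrite lee_fin in r1; have r0 : 0 < r by exact: lt_le_trans r1.
have := h [fset i]%fset; rewrite big_seq_fset1 => {}h.
rewrite leNgt; apply/negP => cx; move: h; rewrite leNgt.
by rewrite gt0_ltr_powR// nnegrE.
Qed.

Lemma lp_leD x y a b : 0 < a -> 0 < b -> lp_le x a -> lp_le y b ->
  lp_le (fun i => x i + y i) (a + b).
Proof.
move=> a0 b0; rewrite /lp_le; case: p p1 => [r r1 xa yb s| |//]; last first.
  by move=> _ xa yb i; rewrite (le_trans (ler_normD _ _))// lerD.
rewrite lee_fin in r1.
apply: le_trans (powR_sum_triangle r1 a0 b0 (fun=> normr_ge0 _)
  (fun=> normr_ge0 _) (xa s) (yb s)).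
apply: ler_sum => i _; apply: ge0_ler_powR; rewrite ?nnegrE ?addr_ge0//.
  exact: le_trans r1.
exact: ler_normD.
Qed.

Lemma lp_leZ (l : R) x c : 0 <= c -> lp_le x c -> lp_le (fun i => l *: x i) (`|l| * c).
Proof.
move=> c0; rewrite /lp_le; case: p p1 => [r r1 xc s| |//]; last first.
  by move=> _ xc i; rewrite normrZ ler_wpM2l ?normr_ge0 ?xc.
rewrite powRM// (eq_bigr (fun i => `|l| `^ r * `|x i| `^ r)); last first.
  by move=> i _; rewrite normrZ powRM.
by rewrite -mulr_sumr ler_wpM2l ?powR_ge0.
Qed.

Lemma lp_le0 c : 0 <= c -> lp_le (fun i => 0 : X i) c.
Proof.
move=> c0; rewrite /lp_le; case: p p1 => [r r1 s| |//]; last first.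
  by move=> _ i; rewrite normr0.
rewrite lee_fin in r1; rewrite big1 ?powR_ge0// => i _.
by rewrite normr0 powR0// gt_eqF// (lt_le_trans _ r1).
Qed.

Lemma lp_le_approx x c : 0 < c ->
  (forall (s : {fset I}) (d : R), 0 < d ->
    exists2 y, lp_le y c & forall i, i \in s -> `|x i - y i| <= d) ->
  lp_le x (c + c).
Proof.
move=> c0; rewrite /lp_le; case: p p1 => [r r1 h| |//]; last first.
  move=> _ h i; have [y yc /(_ i)] := h [fset i]%fset c c0.
  rewrite inE eqxx => /(_ isT) xy.
  by rewrite -(subrK (y i) (x i)) (le_trans (ler_normD _ _))// lerD.
move=> s; rewrite lee_fin in r1.
have r0 : 0 < r by exact: lt_le_trans r1.
pose N : R := (size s).+1%:R.
have N1 : 1 <= N by rewrite ler1n.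
have N0 : 0 < N by rewrite ltr0n.
have [y yc xy] := h s (c / N) (divr_gt0 c0 N0).
pose v i := if i \in s then `|x i - y i| else 0.
have v0 i : 0 <= v i by rewrite /v; case: ifP.
have vc : \sum_(i <- s) v i `^ r <= c `^ r.
  apply: (@le_trans _ _ (\sum_(i <- s) (c / N) `^ r)).
    apply: ler_sum => i _; apply: ge0_ler_powR; rewrite ?nnegrE ?(ltW r0)//.
      by rewrite divr_ge0// ltW.
    by rewrite /v; case: ifPn => [/xy//|_]; rewrite divr_ge0// ltW.
  rewrite big_const_seq count_predT iter_addr_0 -mulr_natl.
  apply: (@le_trans _ _ (N * (c / N) `^ r)).
    by rewrite ler_wpM2r ?powR_ge0// ler_nat.
  rewrite -[in leRHS](divfK (lt0r_neq0 N0) c) [in leRHS]mulrC.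
  by rewrite le1r_powRZ// divr_ge0// ltW.
apply: le_trans (powR_sum_triangle r1 c0 c0 (fun=> normr_ge0 _) v0 (yc s) vc).
rewrite big_seq [leRHS]big_seq; apply: ler_sum => i si.
apply: ge0_ler_powR; rewrite ?nnegrE ?addr_ge0 ?(ltW r0)//.
rewrite /v si -{1}(subrK (y i) (x i)) addrC.
exact: ler_normD.
Qed.

Lemma lp_norm_ge0 x : (lp_norm p x < +oo)%E -> (0 <= fine (lp_norm p x))%R.
Proof.
rewrite /lp_norm; case: p p1 => [r r1 _| |//]; first exact/fine_ge0/poweR_ge0.
move=> _ _.
have [[i _]|I0] := pselect ([set: I] !=set0).
  apply: fine_ge0; apply: le_trans (_ : `|x i|%:E <= _)%E; first by rewrite lee_fin.
  by apply: ereal_sup_ubound; exists i.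
suff -> : [set `|x i|%:E | i in [set: I]] = set0 by rewrite ereal_sup0.
by rewrite -subset0 => y [i iT _]; case: I0; exists i.
Qed.

Lemma lp_norm_le x : (lp_norm p x < +oo)%E -> lp_le x (fine (lp_norm p x)).
Proof.
move=> xoo; apply/lp_normP; first exact: lp_norm_ge0.
by case: (lp_norm p x) xoo => [r| |]// _; rewrite leNye.
Qed.

Lemma lp_norm_min x c : 0 <= c -> lp_le x c ->
  (lp_norm p x < +oo)%E /\ fine (lp_norm p x) <= c.
Proof.
move=> c0 /lp_normP -/(_ c0) h; split; first exact: le_lt_trans h (ltry _).
by case: (lp_norm p x) h.
Qed.

End lp_le.

Section lp_sum_normed.
Context {R : realType} (p : \bar R) (p1 : (1 <= p)%E) {I : choiceType}.
Variable X : I -> completeNormedModType R.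
Local Notation Z := (lp_sum X p1).
Implicit Types (x y z : Z).

HB.instance Definition _ := gen_eqMixin Z.
HB.instance Definition _ := gen_choiceMixin Z.

Lemma lp_sum_ext x y : (forall i, x i = y i) -> x = y.
Proof.
case: x y => [x xf] [y yf] /= xy; have {}xy : x = y by exact: functional_extensionality_dep.
by subst y; congr LpSum; exact: Prop_irrelevance.
Qed.

Let nm x : R := fine (lp_norm p x).

Let nm_ge0 x : 0 <= nm x. Proof. exact/lp_norm_ge0/lp_fin. Qed.

Let nm_le x : lp_le p x (nm x). Proof. exact/lp_norm_le/lp_fin. Qed.

Let zero_fin : (lp_norm p (fun i => 0 : X i)%R < +oo)%E.
Proof. by have [] := lp_norm_min p1 (lexx 0) (lp_le0 p1 X (lexx 0)). Qed.

Let scale_fin (l : R) x : (lp_norm p (fun i => l *: x i)%R < +oo)%E.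
Proof.
by have [] := lp_norm_min p1 (mulr_ge0 (normr_ge0 l) (nm_ge0 x))
  (lp_leZ p1 l (nm_ge0 x) (nm_le x)).
Qed.

Let le_gt x : lp_le p x (nm x + 1).
Proof.
apply/(lp_normP p1); first by rewrite addr_ge0.
apply: le_trans (_ : (nm x)%:E <= _)%E; last by rewrite lee_fin lerDl.
exact/(lp_normP p1).
Qed.

Let add_fin x y : (lp_norm p (fun i => x i + y i)%R < +oo)%E.
Proof.
have x0 : 0 < nm x + 1 by rewrite ltr_wpDl.
have y0 : 0 < nm y + 1 by rewrite ltr_wpDl.
by have [] := lp_norm_min p1 (ltW (addr_gt0 x0 y0)) (lp_leD p1 x0 y0 (le_gt x) (le_gt y)).
Qed.

Let opp_fin x : (lp_norm p (fun i => - x i)%R < +oo)%E.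
Proof.
rewrite (_ : (fun i => - x i) = (fun i => -1 *: x i)); first exact: scale_fin.
by apply: functional_extensionality_dep => i; rewrite scaleN1r.
Qed.

Let zeroZ : Z := LpSum p1 zero_fin.
Let addZ x y : Z := LpSum p1 (add_fin x y).
Let oppZ x : Z := LpSum p1 (opp_fin x).
Let scaleZ (l : R) x : Z := LpSum p1 (scale_fin l x).

Let addZA : associative addZ.
Proof. by move=> x y z; apply: lp_sum_ext => i /=; rewrite addrA. Qed.
Let addZC : commutative addZ.
Proof. by move=> x y; apply: lp_sum_ext => i /=; rewrite addrC. Qed.
Let add0Z : left_id zeroZ addZ.
Proof. by move=> x; apply: lp_sum_ext => i /=; rewrite add0r. Qed.
Let addNZ : left_inverse zeroZ oppZ addZ.
Proof. by move=> x; apply: lp_sum_ext => i /=; rewrite addNr. Qed.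

HB.instance Definition _ := GRing.isZmodule.Build Z addZA addZC add0Z addNZ.

Let scaleZA a b x : scaleZ a (scaleZ b x) = scaleZ (a * b) x.
Proof. by apply: lp_sum_ext => i /=; rewrite scalerA. Qed.
Let scale1Z : left_id 1 scaleZ.
Proof. by move=> x; apply: lp_sum_ext => i /=; rewrite scale1r. Qed.
Let scaleZDr : right_distributive scaleZ +%R.
Proof. by move=> a x y; apply: lp_sum_ext => i /=; rewrite scalerDr. Qed.
Let scaleZDl x : {morph scaleZ^~ x : a b / a + b}.
Proof. by move=> a b; apply: lp_sum_ext => i /=; rewrite scalerDl. Qed.

HB.instance Definition _ :=
  GRing.Zmodule_isLmodule.Build R Z scaleZA scale1Z scaleZDr scaleZDl.

Let nm_eq0 x : nm x = 0 -> x = 0.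
Proof.
move=> x0; apply: lp_sum_ext => i; apply/eqP; rewrite -normr_le0.
by apply: (lp_le_coord p1 _ (lexx 0)); rewrite -x0; exact: nm_le.
Qed.

Let nm0 : nm 0 = 0.
Proof.
apply/eqP; rewrite eq_le nm_ge0 andbT.
by have [] := lp_norm_min p1 (lexx 0) (lp_le0 p1 X (lexx 0)).
Qed.

Let nmD x y : nm (x + y) <= nm x + nm y.
Proof.
have [/nm_eq0 ->|x0] := eqVneq (nm x) 0; first by rewrite add0r nm0 add0r.
have [/nm_eq0 ->|y0] := eqVneq (nm y) 0; first by rewrite addr0 nm0 addr0.
have {}x0 : 0 < nm x by rewrite lt_neqAle eq_sym x0 nm_ge0.
have {}y0 : 0 < nm y by rewrite lt_neqAle eq_sym y0 nm_ge0.
by have [] := lp_norm_min p1 (ltW (addr_gt0 x0 y0)) (lp_leD p1 x0 y0 (nm_le x) (nm_le y)).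
Qed.

Let nmZ_le (l : R) x : nm (l *: x) <= `|l| * nm x.
Proof.
by have [] := lp_norm_min p1 (mulr_ge0 (normr_ge0 l) (nm_ge0 x))
  (lp_leZ p1 l (nm_ge0 x) (nm_le x)).
Qed.

Let nmZ (l : R) x : nm (l *: x) = `|l| * nm x.
Proof.
have [->|l0] := eqVneq l 0; first by rewrite scale0r nm0 normr0 mul0r.
apply/eqP; rewrite eq_le nmZ_le/=.
rewrite -ler_pdivlMl ?normr_gt0// -normfV.
by rewrite -{1}(scale1r x) -(mulVf l0) -scalerA nmZ_le.
Qed.

HB.instance Definition _ := @Lmodule_isNormed.Build R Z nm nmD nmZ nm_eq0.

(* When I is empty and p = +oo, lp_norm is the supremum -oo of the empty set. *)
Lemma lp_sum_normE x : [set: I] !=set0 -> `|x|%:E = lp_norm p x.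
Proof.
move=> [i _]; rewrite -[ `|x| ]/(nm x) fineK// ge0_fin_numE ?lp_fin//.
move: (lp_coord x); rewrite /lp_norm; case: p => [r y|y|//]; first exact: poweR_ge0.
apply: (@le_trans _ _ `|y i|%:E); first by rewrite lee_fin.
by apply: ereal_sup_ubound; exists i.
Qed.

Lemma lp_sum_norm_le x c : 0 <= c -> `|x| <= c <-> lp_le p x c.
Proof.
move=> c0; split=> [xc|/(lp_norm_min p1 c0)[]//].
apply/(lp_normP p1) => //; apply: (@le_trans _ _ (nm x)%:E).
  exact/(lp_normP p1).
by rewrite lee_fin.
Qed.

Lemma lp_sum_coord_le x i : `|x i| <= `|x|.
Proof.
apply: (lp_le_coord p1 _ (normr_ge0 _)).
exact/lp_sum_norm_le.
Qed.

Let lp_complete (F : set_system Z) : ProperFilter F -> cauchy F -> cvg F.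
Proof.
move=> FF /cauchyP Fc.
pose G i : set_system (X i) := (fun z : Z => z i) @ F.
have Gl i : {l : X i | forall d : R, 0 < d -> F [set z : Z | `|l - z i| <= d]}.
  apply: cid; have GP : ProperFilter (G i) by exact: fmap_proper_filter.
  have /cauchy_cvg/cvg_ex[l Gl] : cauchy (G i).
    apply/cauchyP => e e0; have [z Fz] := Fc e e0.
    exists (z i); rewrite /G/=; apply: filterS Fz => y.
    rewrite -!ball_normE /ball_/= => /le_lt_trans -> //.
    exact: (lp_sum_coord_le (z - y) i).
  by exists l => d d0; move/cvgrPdist_le : Gl => /(_ d d0).
pose l i := sval (Gl i).
have near_l (e : R) : 0 < e -> exists2 z : Z, F (ball z e) &
    lp_le p (fun i => z i - l i) (e + e).
  move=> e0; have [z Fz] := Fc e e0; exists z => //.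
  apply: (lp_le_approx p1 e0) => s d d0.
  have FF' : Filter F by typeclasses eauto.
  have Fs := @filter_bigI _ _ s (fun i => [set y : Z | `|l i - y i| <= d]) F FF'
    (fun i _ => svalP (Gl i) d d0).
  have [y [zy ys]] := filter_ex (filterI Fz Fs).
  exists (z - y).
    apply/lp_sum_norm_le; first exact: ltW.
    by apply: ltW; move: zy; rewrite -ball_normE.
  move=> i si /=; rewrite (_ : z i - l i - _ = - (l i - y i)).
    by rewrite normrN; exact: ys.
  by rewrite !opprB addrC addrA subrK.
have [z0 _ z0l] := near_l 1 ltr01.
have [dfin _] := lp_norm_min p1 (addr_ge0 ler01 ler01) z0l.
pose w : Z := z0 - LpSum p1 dfin.
have wE i : w i = l i.
  by rewrite -[w i]/(z0 i - (z0 i - l i)) opprB addrCA subrr addr0.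
apply/cvg_ex; exists w; apply/cvgrPdist_le => e e0.
have e3 : 0 < e / 3 by rewrite divr_gt0.
have [z Fz zl] := near_l _ e3.
apply: filterS Fz => y; rewrite -ball_normE /ball_/= => zy.
have zw : `|z - w| <= e / 3 + e / 3.
  apply/lp_sum_norm_le; first by rewrite addr_ge0 ?ltW.
  rewrite (_ : lp_coord (z - w) = (fun i => z i - l i))//.
  by apply: functional_extensionality_dep => i; rewrite -wE.
rewrite -(subrK z w) -addrA (le_trans (ler_normD _ _))// distrC.
have -> : e = e / 3 + e / 3 + e / 3 by field.
by rewrite lerD// ltW.
Qed.

HB.instance Definition _ := Uniform_isComplete.Build Z lp_complete.

End lp_sum_normed.

(* Main.v *)
(** A replacement of the coordinates [z i], [i] in a finite set [s], by vectors
    [a i] with [`|a i| <= `|z i|] does not increase the norm of [z], whatever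
    [p] is, and if two such families satisfy [`|a i - b i| >= (2 - t) * `|z i|]
    on [s], the two results are at distance at least [(2 - t) * `|P z|], where
    [P z] is the restriction of [z] to [s]; moreover [`|P z|] is as close to
    [`|z|] as wanted.  Scaled to the ball of radius [`|z i|], the hypothesis on
    [X i] gives [a i] and [b i] on which finitely many functionals (for slices,
    one functional from below) nearly agree with their value at [z i].  It
    remains to start from a [z] of norm close to 1: for slices this is automatic,
    for a weakly open set [z] is first moved to the unit sphere. *)
From HB Require Import structures.
Require Import Defs.
From mathcomp Require Import all_boot all_order all_algebra finmap.
From mathcomp Require Import lra ring.
From mathcomp Require Import all_classical all_reals all_analysis.
Import Order.TTheory GRing.Theory Num.Theory.
Import numFieldNormedType.Exports.

Set Implicit Arguments.
Unset Strict Implicit.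
Unset Printing Implicit Defensive.

Local Open Scope classical_set_scope.
Local Open Scope ring_scope.

(** * Linearity of functionals *)

Section dual_linear.
Context {R : realType} {X : normedModType R}.
Implicit Types (f : dual X) (x y : X).

Lemma dual0 f : f 0 = 0. Proof. exact: linear0. Qed.

Lemma dualZ f t x : f (t *: x) = t * f x. Proof. exact: linearZ. Qed.

Lemma dualD f x y : f (x + y) = f x + f y. Proof. exact: linearD. Qed.

Lemma dualB f x y : f (x - y) = f x - f y. Proof. exact: linearB. Qed.

Lemma dual_sum f J (s : seq J) (F : J -> X) :
  f (\sum_(i <- s) F i) = \sum_(i <- s) f (F i).
Proof. exact: linear_sum. Qed.

End dual_linear.

(** * Basic neighbourhoods of the weak topology *)

Section weak_topology.
Context {R : realType} {X : normedModType R}.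

(** An arbitrary finite index type lets two families be joined over [K + L]. *)
Definition weak_ball (K : finType) (F : K -> dual X) (z : X) (e : R) : set X :=
  [set y | forall k, `|F k y - F k z| < e].

Lemma weak_continuous (f : dual X) : continuous (f : weak X -> R^o).
Proof.
apply/continuousP => A oA.
rewrite openE => y Ay.
pose Tc (g : dual X) := Topological.class (initial_topology (g : X -> R^o)).
(* The weak neighbourhood filter of [y] converges to [y] in the supremum topology, hence in each
   initial topology. *)
have /(_ f) cf := (@cvg_sup X _ Tc (nbhs (y : weak X)) y (@nbhs_filter (weak X) y)).1 (fun _ => id).
by apply: cf; apply: open_nbhs_nbhs; split => //; exists A.
Qed.

Lemma weakly_open_weak_ball (K : finType) (F : K -> dual X) z e :
  weakly_open (weak_ball F z e).
Proof.
rewrite /weakly_open openE => y yF.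
apply: (@filter_forall _ _ _ (nbhs (y : weak X)) (@nbhs_filter (weak X) y)) => k.
have : open ((F k : weak X -> R^o) @^-1` [set t | `|t - F k z| < e]).
  apply: (@open_comp (weak X) R^o).
    by move=> ? _; exact: weak_continuous.
  rewrite (_ : mkset _ = ball (F k z : R^o) e); first exact: ball_open.
  by rewrite -ball_normE; apply/seteqP; split => t /=; rewrite distrC.
by rewrite openE; apply; exact: yF.
Qed.

(** The sets containing a weak ball around [z] form a filter [B]. It converges to [z] in every
    initial topology, hence in their supremum, so it contains all weak neighbourhoods of [z]. *)
Lemma weakly_open_sub_weak_ball (U : set X) z : weakly_open U -> U z ->
  exists (K : finType) (F : K -> dual X) (e : R),
    0 < e /\ weak_ball F z e `<=` U.
Proof.
move=> oU Uz.
pose B := [set A : set X | exists (K : finType) (F : K -> dual X) (e : R),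
  0 < e /\ weak_ball F z e `<=` A].
have FB : Filter B.
  split.
  - by exists void, (fun k : void => match k with end), 1.
  - move=> P Q [K [F [e [e0 FP]]]] [L [G [d [d0 GQ]]]].
    exists (K + L)%type, (fun k => match k with inl k => F k | inr k => G k end),
      (Num.min e d); split; first by rewrite lt_min e0.
    move=> y yF; split.
      by apply: FP => k; have := yF (inl k); rewrite lt_min => /andP[].
    by apply: GQ => k; have := yF (inr k); rewrite lt_min => /andP[].
  - by move=> P Q PQ [K [F [e [e0 /subset_trans/(_ PQ) FP]]]]; exists K, F, e.
suff : nbhs (z : weak X) `<=` B by apply; exact: open_nbhs_nbhs.
pose Tc (g : dual X) := Topological.class (initial_topology (g : X -> R^o)).
apply: (@cvg_sup X _ Tc B z FB).2 => f A; rewrite nbhsE => -[_ [[V oV <-] Vz] VA].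
have : nbhs (f z : R^o) V by exact: open_nbhs_nbhs.
move=> /nbhs_ballP[e /= e0 eV].
exists unit, (fun=> f), e; split=> // y /(_ tt) yf.
by apply: VA; apply: eV; rewrite -ball_normE /= distrC.
Qed.

End weak_topology.

(** * Diameter 2 in terms of almost optimal pairs *)

Section diam.
Context {R : realType} {X : normedModType R}.
Implicit Type A : set X.

(** In the unit ball the upper bound 2 is automatic. Restricting to [d < 1] loses nothing, since a
    pair for a small [d] serves every larger one. *)
Lemma diam_eq2P A : A `<=` unit_ball X ->
  diam A = 2%:E <->
  forall d : R, 0 < d -> d < 1 -> exists x y, [/\ A x, A y & 2 - d <= `|x - y|].
Proof.
move=> AB; split=> [A2 d d0 _|h].
  have : ((2 - d)%:E < diam A)%E by rewrite A2 lte_fin; lra.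
  move=> /ereal_sup_gt[_ [x Ax [y Ay <-]]]; rewrite lte_fin => xy.
  by exists x, y; split=> //; exact: ltW.
apply/eqP; rewrite eq_le; apply/andP; split.
  apply/ereal_supP => _ [x Ax [y Ay <-]]; rewrite lee_fin.
  by have := AB _ Ax; have := AB _ Ay; have := ler_normB x y; rewrite /unit_ball/=; lra.
apply/lee_subgt0Pr => e e0.
pose d := Num.min e (1/2).
have d0 : 0 < d by rewrite lt_min e0/=; lra.
have d1 : d < 1 by rewrite gt_min; apply/orP; right; lra.
have de : d <= e by rewrite ge_min lexx.
have [x [y [Ax Ay xy]]] := h d d0 d1.
apply: (@le_trans _ _ `|x - y|%:E); first by rewrite -EFinB lee_fin; lra.
by apply: ereal_sup_ubound; exists x => //; exists y.
Qed.

End diam.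

(** * Rescaling the diameter properties to balls of any radius *)

Section scaled_balls.
Context {R : realType} {X : normedModType R}.

(** Scaling by [r] turns the tolerance [d / r] at [z / r] into [d] at [z]. The radius may exceed
    [|z|]: [weak_ball_sphere] takes radius 2 to get long vectors. *)
Lemma diameter2_ball (K : finType) (F : K -> dual X) z r d :
  diameter2 X -> 0 < r -> `|z| <= r -> 0 < d -> d < 1 ->
  exists x y, [/\ `|x| <= r, `|y| <= r, weak_ball F z d x, weak_ball F z d y &
    (2 - d) * r <= `|x - y|].
Proof.
move=> X2 r0 zr d0 d1.
pose U := weak_ball F (r^-1 *: z) (r^-1 * d).
have [] : exists x y, [/\ (U `&` unit_ball X) x, (U `&` unit_ball X) y &
   2 - d <= `|x - y|].
  apply: (diam_eq2P _).1 => //; apply: X2; first exact: weakly_open_weak_ball.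
  exists (r^-1 *: z); split.
    by move=> k; rewrite subrr normr0 mulr_gt0// invr_gt0.
  by rewrite /unit_ball/= normrZ gtr0_norm ?invr_gt0// ler_pdivrMl// mulr1.
move=> x [y [[xU xB] [yU yB] xy]].
have scale w : U w -> weak_ball F z d (r *: w).
  move=> wU k; have := wU k.
  rewrite -dualB -{1}(scalerK (lt0r_neq0 r0) w) -scalerBr dualZ.
  by rewrite normrM gtr0_norm ?invr_gt0// ltr_pM2l ?invr_gt0// dualB.
have nm w : unit_ball X w -> `|r *: w| <= r.
  by move=> wB; rewrite normrZ gtr0_norm// ler_piMr// ltW.
exists (r *: x), (r *: y); split; [exact: nm|exact: nm|exact: scale|exact: scale|].
by rewrite -scalerBr normrZ gtr0_norm// mulrC ler_wpM2l// ltW.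
Qed.

Lemma diameter2_sphere (K : finType) (F : K -> dual X) z d :
  diameter2 X -> 0 < d -> d < 1 ->
  exists x y, [/\ `|x| <= `|z|, `|y| <= `|z|, weak_ball F z d x,
    weak_ball F z d y & (2 - d) * `|z| <= `|x - y|].
Proof.
move=> X2 d0 d1; have [->|z0] := eqVneq z 0.
  have b0 : weak_ball F 0 d 0 by move=> k; rewrite subrr normr0.
  by exists 0, 0; rewrite subrr normr0 mulr0.
by apply: diameter2_ball => //; rewrite normr_gt0.
Qed.

Lemma dual_bounded (g : dual X) :
  exists2 M : R, 0 < M & forall x, `|g x| <= M * `|x|.
Proof.
case: g => g cg.
have /pinfty_ex_gt0[M M0 gM] :=
  (linear_boundedP g).1 ((linear_bounded_continuous g).2 cg).
by exists M.
Qed.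

Lemma dual_norm_le (g : dual X) (c : R) : 0 <= c ->
  (dual_norm g <= c%:E)%E <-> forall x, `|g x| <= c * `|x|.
Proof.
move=> c0; split=> [/ereal_supP gc x|gc].
  have [->|x0] := eqVneq x 0; first by rewrite dual0 !normr0 mulr0.
  have /gc : [set `|g x|%:E | x in unit_ball X] `|g (`|x|^-1 *: x)|%:E.
    exists (`|x|^-1 *: x) => //.
    by rewrite /unit_ball/= normrZ normfV normr_id mulVf// normr_eq0.
  rewrite lee_fin dualZ normrM normfV normr_id.
  by rewrite ler_pdivrMl ?normr_gt0// mulrC.
apply/ereal_supP => _ [x xB <-]; rewrite lee_fin.
by rewrite (le_trans (gc x))// ler_piMr.
Qed.

Lemma dual_norm_fin (g : dual X) : dual_norm g \is a fin_num.
Proof.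
have [M M0 gM] := dual_bounded g.
rewrite fin_numElt; apply/andP; split.
  apply: (@lt_le_trans _ _ `|g 0|%:E); first exact: ltNyr.
  by apply: ereal_sup_ubound; exists 0 => //; rewrite /unit_ball/= normr0.
by apply: le_lt_trans (ltry M); apply/dual_norm_le => //; exact: ltW.
Qed.

Lemma dual_norm_ge0 (g : dual X) : (0 <= dual_norm g)%E.
Proof.
apply: (@le_trans _ _ `|g 0|%:E); first by rewrite lee_fin.
by apply: ereal_sup_ubound; exists 0 => //; rewrite /unit_ball/= normr0.
Qed.

(** The diameter hypothesis speaks of functionals of norm 1 only, whereas the restriction of a
    functional to a summand can have another norm. *)
Lemma dual_normalize (g : dual X) : (exists x, g x != 0) ->
  exists c (h : dual X), [/\ 0 < c, dual_sphere h & forall x, g x = c * h x].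
Proof.
move=> [x0 gx0]; pose c := fine (dual_norm g).
have cE : dual_norm g = c%:E by rewrite fineK// dual_norm_fin.
have c0 : 0 <= c by rewrite -lee_fin -cE dual_norm_ge0.
have gc : forall x, `|g x| <= c * `|x| by apply/dual_norm_le; rewrite ?cE.
have {}c0 : 0 < c.
  rewrite lt_neqAle c0 andbT; apply: contra_neq gx0 => c0'.
  by have := gc x0; rewrite -c0' mul0r normr_le0 => /eqP.
have [h hE] : exists h : dual X, forall x, h x = c^-1 * g x.
  have cont : continuous (c^-1 \*: sval g : {linear X -> R^o}).
    move=> x; by apply: cvgZl_tmp; exact: (svalP g x).
  by exists (exist _ (c^-1 \*: sval g : {linear X -> R^o}) cont).
have gE x : g x = c * h x by rewrite hE mulVKf// gt_eqF.
exists c, h; split => //; apply/eqP; rewrite eq_le; apply/andP; split.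
  apply/dual_norm_le => // x; rewrite mul1r hE normrM gtr0_norm ?invr_gt0//.
  by rewrite ler_pdivrMl.
(* A bound [k] for [h] gives the bound [c * k] for [g], so [c <= c * k] and [1 <= k]. *)
pose k := fine (dual_norm h).
have kE : dual_norm h = k%:E by rewrite fineK// dual_norm_fin.
have k0 : 0 <= k by rewrite -lee_fin -kE dual_norm_ge0.
have hk : forall x, `|h x| <= k * `|x| by apply/dual_norm_le; rewrite ?kE.
rewrite kE lee_fin -(ler_pM2l c0) mulr1 -lee_fin -cE.
apply/dual_norm_le; first by rewrite mulr_ge0// ltW.
by move=> x; rewrite gE normrM gtr0_norm// -mulrA ler_pM2l.
Qed.

(* The slice of the unit ball used here is the scaled half space
   [g x > g z - d]; its width [e] is positive because [h (z / |z|) <= 1]. *)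
Lemma local_diameter2_sphere (g : dual X) z d :
  local_diameter2 X -> 0 < d -> d < 1 ->
  exists x y, [/\ `|x| <= `|z|, `|y| <= `|z|, g z - d < g x, g z - d < g y &
    (2 - d) * `|z| <= `|x - y|].
Proof.
move=> X2 d0 d1; have [->|z0] := eqVneq z 0.
  by exists 0, 0; rewrite subrr normr0 mulr0 ltrBlDr ltrDl.
have r0 : 0 < `|z| by rewrite normr_gt0.
have [/dual_normalize[c [h [c0 h1 gE]]]|/forallNP g0] :=
  pselect (exists x, g x != 0); last first.
  have {}g0 x : g x = 0 by have /negP/negPn/eqP := g0 x.
  (* For [g = 0] there is nothing to normalize, but [z] and [- z] are at distance [2 * |z|]. *)
  exists z, (- z); rewrite normrN opprK !g0 sub0r oppr_lt0; split => //.
  by rewrite -mulr2n normrMn -(mulr_natl `|z|)// ler_pM2r//; lra.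
pose e := 1 - h (`|z|^-1 *: z) + d / (c * `|z|).
have hz : h (`|z|^-1 *: z) <= 1.
  have : forall x, `|h x| <= 1 * `|x| by apply/dual_norm_le => //; rewrite h1.
  move=> /(_ (`|z|^-1 *: z)); rewrite normrZ normfV normr_id mulVf ?gt_eqF// mulr1.
  exact/le_trans/ler_norm.
have dc0 : 0 < d / (c * `|z|) by rewrite divr_gt0// mulr_gt0.
have e0 : 0 < e by rewrite /e; lra.
have sB : slice h e `<=` unit_ball X by move=> x [].
have [x [y [[xB xh] [yB yh] xy]]] := (diam_eq2P sB).1 (X2 h e h1 e0) d d0 d1.
have nm w : unit_ball X w -> `| `|z| *: w| <= `|z|.
  by move=> wB; rewrite normrZ normr_id ler_piMr.
have gt w : h w > 1 - e -> g z - d < g (`|z| *: w).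
  rewrite (_ : 1 - e = h (`|z|^-1 *: z) - d / (c * `|z|)); last by rewrite /e; ring.
  rewrite !gE !dualZ => hw.
  have -> : c * h z - d = (c * `|z|) * (`|z|^-1 * h z - d / (c * `|z|)).
    by field; rewrite !gt_eqF.
  by rewrite mulrA ltr_pM2l ?mulr_gt0.
exists (`|z| *: x), (`|z| *: y); split; [exact: nm|exact: nm|exact: gt|exact: gt|].
by rewrite -scalerBr normrZ normr_id mulrC ler_pM2l.
Qed.

End scaled_balls.

(** * Summands, finite restrictions and replacements in the sum *)

Section lp_embed.
Context {R : realType} (p : \bar R) (p1 : (1 <= p)%E) {I : choiceType}.
Variable X : I -> completeNormedModType R.
Local Notation Z := (lp_sum X p1).
Implicit Types (x y z : Z) (s : {fset I}) (i j : I) (a b : forall i, X i).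

Lemma lp_sum_coordD x y i : (x + y) i = x i + y i. Proof. by []. Qed.
Lemma lp_sum_coordN x i : (- x) i = - x i. Proof. by []. Qed.
Lemma lp_sum_coordZ (t : R) x i : (t *: x) i = t *: x i. Proof. by []. Qed.
Lemma lp_sum_coord0 i : (0 : Z) i = 0. Proof. by []. Qed.

(** Both estimates on replacements, [lp_replace_norm] and [lp_replace_dist], reduce to this
    comparison, uniformly in [p]. *)
Lemma lp_sum_norm_mono x y : (forall i, `|x i| <= `|y i|) -> `|x| <= `|y|.
Proof.
move=> xy; apply/lp_sum_norm_le => //.
have : lp_le p y `|y| by apply/lp_sum_norm_le.
rewrite /lp_le; case: p p1 x y xy => [r r1|q1|q1] x y xy h.
- move=> s; apply: le_trans (h s); apply: ler_sum => i _.
  by apply: ge0_ler_powR; rewrite ?nnegrE ?normr_ge0//; move: (r1); rewrite lee_fin; lra.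
- by move=> i; exact: le_trans (xy i) (h i).
- by move=> i; exact: le_trans (xy i) (h i).
Qed.

Lemma lp_le_dfwith i (u : X i) : lp_le p (dfwith (fun j => 0 : X j) i u) `|u|.
Proof.
rewrite /lp_le; case: p p1 => [r r1 s| |//]; last first.
  by move=> _ j; case: dfwithP => [|k _]; rewrite ?normr0.
have r0 : r != 0 by rewrite gt_eqF//; move: (r1); rewrite lee_fin; lra.
have out j : i != j -> `|dfwith (fun j => 0 : X j) i u j| `^ r = 0.
  by move=> ij; rewrite dfwithout// normr0 powR0.
have [si|si] := boolP (i \in s).
  rewrite (bigD1_seq i)//= ?fset_uniq// big1 ?addr0 ?dfwithin// => j ji.
  by rewrite out// eq_sym.
rewrite big_seq big1 ?powR_ge0// => j sj; rewrite out//.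
by apply: contraNneq si => ->.
Qed.

Definition lp_embed i (u : X i) : Z :=
  LpSum p1 (lp_norm_min p1 (normr_ge0 u) (lp_le_dfwith u)).1.

Lemma lp_embedE i (u : X i) j : lp_embed u j = dfwith (fun j => 0 : X j) i u j.
Proof. by []. Qed.

Lemma lp_embed_linear i : linear (@lp_embed i).
Proof.
move=> t u v; apply: lp_sum_ext => j.
rewrite lp_sum_coordD lp_sum_coordZ !lp_embedE.
have [<-|ij] := eqVneq i j; first by rewrite !dfwithin.
by rewrite !dfwithout// scaler0 addr0.
Qed.

HB.instance Definition _ i :=
  GRing.isLinear.Build R (X i) Z _ (@lp_embed i) (@lp_embed_linear i).

Lemma lp_embed_norm i (u : X i) : `|lp_embed u| <= `|u|.
Proof. by apply/lp_sum_norm_le => //; exact: lp_le_dfwith. Qed.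

Lemma lp_embed_continuous i : continuous (@lp_embed i).
Proof.
apply/linear_bounded_continuous/bounded_funP => r; exists r => u.
exact/le_trans/lp_embed_norm.
Qed.

Lemma dual_lp_embed_continuous (f : dual Z) i :
  continuous (sval f \o @lp_embed i : X i -> R^o).
Proof.
move=> u; apply: continuous_comp; first exact: lp_embed_continuous.
exact: (svalP f).
Qed.

(** Restrictions to the summands are all that is used of [f]; no description of the dual of [Z]
    enters. *)
Definition dual_lp_embed (f : dual Z) i : dual (X i) :=
  exist _ (sval f \o @lp_embed i : {linear X i -> R^o})
    (@dual_lp_embed_continuous f i).

(** As a finite sum of embedded vectors it lies in [Z] for any [a], and functionals act on it term
    by term. *)
Definition lp_patch s a : Z := \sum_(i <- s) lp_embed (a i).

Lemma lp_patchE s a j : lp_patch s a j = if j \in s then a j else 0.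
Proof.
rewrite /lp_patch (big_morph (fun z : Z => z j)
  (fun x y => lp_sum_coordD x y j) (lp_sum_coord0 j)).
have [sj|sj] := boolP (j \in s).
  rewrite (bigD1_seq j)//= ?fset_uniq// big1 ?addr0 ?dfwithin// => i ij.
  by rewrite dfwithout.
rewrite big_seq big1// => i si; rewrite lp_embedE dfwithout//.
by apply: contraNneq sj => <-.
Qed.

Lemma lp_le_fset (u : forall i, X i) (v : {fset I} -> forall i, X i) c :
  (forall s i, i \in s -> v s i = u i) -> (forall s, lp_le p (v s) c) ->
  lp_le p u c.
Proof.
rewrite /lp_le; case: p p1 => [r _|_|//] vu h.
  move=> s; apply: le_trans (h s s).
  by rewrite big_seq [leRHS]big_seq; apply: ler_sum => i si; rewrite vu.
by move=> i; rewrite -(vu [fset i]%fset) ?h// inE.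
Qed.

(** The condition [lp_le] tests only finite sets of coordinates, so a bound on all finite
    restrictions bounds [z]. This covers [p = +oo], where finitely supported vectors need not be
    dense. *)
Lemma lp_patch_norm_gt z c : 0 <= c -> c < `|z| ->
  exists s, c < `|lp_patch s z|.
Proof.
move=> c0 cz; apply/not_existsP => h; move: cz; rewrite ltNge => /negP; apply.
apply/lp_sum_norm_le => //.
apply: (@lp_le_fset _ (fun s => lp_patch s z)) => s => [i si|].
  by rewrite lp_patchE si.
by apply/lp_sum_norm_le => //; rewrite leNgt; apply/negP.
Qed.

Definition lp_replace s a z : Z := z + lp_patch s (fun i => a i - z i).

Lemma lp_replaceE s a z j : lp_replace s a z j = if j \in s then a j else z j.
Proof.
rewrite /lp_replace lp_sum_coordD lp_patchE; case: ifP => _; last by rewrite addr0.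
by rewrite addrC subrK.
Qed.

Lemma lp_replace_norm s a z : (forall i, `|a i| <= `|z i|) ->
  `|lp_replace s a z| <= `|z|.
Proof.
by move=> az; apply: lp_sum_norm_mono => i; rewrite lp_replaceE; case: ifP.
Qed.

Lemma lp_replace_dist s a b z (t : R) : 0 <= t ->
  (forall i, t * `|z i| <= `|a i - b i|) ->
  t * `|lp_patch s z| <= `|lp_replace s a z - lp_replace s b z|.
Proof.
move=> t0 tab; rewrite -{1}(ger0_norm t0) -normrZ; apply: lp_sum_norm_mono => i.
rewrite lp_sum_coordZ lp_sum_coordD lp_sum_coordN !lp_replaceE lp_patchE.
case: ifP => _; last by rewrite scaler0 normr0.
by rewrite normrZ ger0_norm//; exact: tab.
Qed.

Lemma dual_lp_replace (f : dual Z) s a z :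
  f (lp_replace s a z) =
    f z + \sum_(i <- s) (dual_lp_embed f i (a i) - dual_lp_embed f i (z i)).
Proof.
rewrite /lp_replace dualD dual_sum; congr (_ + _).
by apply: eq_bigr => i _; rewrite -dualB.
Qed.

End lp_embed.

(** * The two diameter properties of the sum *)

Section diameter2_lp_sum.
Context {R : realType} (p : \bar R) (p1 : (1 <= p)%E) {I : choiceType}.
Variable X : I -> completeNormedModType R.
Local Notation Z := (lp_sum X p1).
Implicit Types (z : Z).

(* A long vector [u] of [X i] that the functionals do not distinguish from
   [z i] pushes [z] out of the unit ball; the segment crosses the sphere. *)
Lemma weak_ball_sphere i (K : finType) (F : K -> dual Z) z e :
  diameter2 (X i) -> 0 < e -> `|z| <= 1 ->
  exists2 w, weak_ball F z e w & `|w| = 1.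
Proof.
move=> X2 e0 z1.
have [u u1 uF] : exists2 u : X i, 1 <= `|u| &
    weak_ball (fun k => dual_lp_embed (F k) i) (z i) e u.
  pose d := Num.min e (1/2).
  have d0 : 0 < d by rewrite lt_min e0/=; lra.
  have d1 : d <= 1/2 by rewrite ge_min lexx orbT.
  have sub : weak_ball (fun k => dual_lp_embed (F k) i) (z i) d `<=`
      weak_ball (fun k => dual_lp_embed (F k) i) (z i) e.
    by move=> w wF k; apply: lt_le_trans (wF k) _; rewrite ge_min lexx.
  have zi1 : `|z i| <= 1 by exact: le_trans (lp_sum_coord_le z i) z1.
  (* With radius 2 and [d <= 1/2] the distance of [x] and [y] is at least 3, so one of them has norm
     at least 1. *)
  have [||||x [y [_ _ xF yF xy]]] :=
    diameter2_ball (fun k => dual_lp_embed (F k) i) (z := z i) (r := 2) (d := d) X2.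
  - by [].
  - by lra.
  - by [].
  - by lra.
  have [x1|x1] := leP 1 `|x|; first by exists x => //; exact: sub.
  exists y; last exact: sub.
  by have := ler_normB x y; nra.
pose v : Z := lp_embed p1 (u - z i).
pose f (t : R) := `|z + t *: v|.
have fc : continuous f.
  move=> t; apply: (@cvg_norm _ Z).
  by apply: cvgD; [exact: cvg_cst|exact: scalel_continuous].
have f0 : f 0 = `|z| by rewrite /f scale0r addr0.
have f1 : 1 <= f 1.
  apply: (le_trans u1); rewrite /f scale1r.
  rewrite -[u](subrK (z i)) addrC -[X in `|_ + X|](dfwithin (fun j => 0 : X j)).
  exact: (lp_sum_coord_le (z + v) i).
have [||t /[!in_itv]/= /andP[t0 t1] ft] := @IVT R f 0 1 1 ler01.
- exact: continuous_subspaceT.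
- by rewrite f0 ge_min le_max z1 f1 orbT.
exists (z + t *: v) => // k.
rewrite dualD addrAC subrr add0r dualZ normrM ger0_norm//.
have : `|F k v| < e by have := uF k; rewrite -dualB.
by have := normr_ge0 (F k v); nra.
Qed.

(* [W t i] is the set of replacements of the coordinate [z i] that are allowed
   for the tolerance [t]; the finite support [s] has to be chosen before [t],
   since the errors of the [size s] coordinates add up. *)
Lemma lp_replace_spread (W : R -> forall i, set (X i)) z d e :
  (forall t i, 0 < t -> t < 1 -> exists x y, [/\ `|x| <= `|z i|, `|y| <= `|z i|,
    W t i x, W t i y & (2 - t) * `|z i| <= `|x - y|]) ->
  0 < d -> d < 1 -> 1 - d / 4 < `|z| -> 0 < e ->
  exists (s : {fset I}) (t : R) (a b : forall i, X i),
    [/\ \sum_(i <- s) t <= e,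
      forall i, `|a i| <= `|z i| /\ W t i (a i),
      forall i, `|b i| <= `|z i| /\ W t i (b i) &
      2 - d <= `|lp_replace s a z - lp_replace s b z|].
Proof.
move=> Wz d0 d1 dz e0.
have [|s sz] := lp_patch_norm_gt _ dz; first by lra.
(* The successor keeps [N] positive when [s] is empty. *)
pose N : R := (size s).+1%:R.
have N0 : 0 < N by rewrite ltr0n.
pose t := Num.min (d / 2) (e / N).
have t0 : 0 < t by rewrite lt_min !divr_gt0.
have td : t <= d / 2 by rewrite ge_min lexx.
have t1 : t < 1 by lra.
have tN : t * N <= e by rewrite -ler_pdivlMr// ge_min lexx orbT.
have H i : exists q : X i * X i, [/\ `|q.1| <= `|z i|, `|q.2| <= `|z i|,
    W t i q.1, W t i q.2 & (2 - t) * `|z i| <= `|q.1 - q.2|].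
  by have [x [y xy]] := Wz t i t0 t1; exists (x, y).
pose q i := sval (cid (H i)).
have qP i := svalP (cid (H i)).
exists s, t, (fun i => (q i).1), (fun i => (q i).2); split.
- apply: le_trans tN; rewrite big_const_seq count_predT iter_addr_0 -mulr_natr.
  by rewrite ler_pM2l// ler_nat.
- by move=> i; have [] := qP i.
- by move=> i; have [] := qP i.
have t2 : 0 <= 2 - t by lra.
(* The remaining inequality is [(2 - d / 2) * (1 - d / 4) = 2 - d + d ^ 2 / 8 >= 2 - d]. *)
apply: le_trans (lp_replace_dist s t2 (fun i => let: And5 _ _ _ _ h := qP i in h)).
by nra.
Qed.

(** The given point [z0] may be short, which would leave the replacements close together. Half of
    the tolerance [e] pays for moving it to the sphere, half for the replacements. *)
Lemma diameter2_lp_sum : [set: I] !=set0 ->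
  (forall i, diameter2 (X i)) -> diameter2 Z.
Proof.
move=> [i0 _] X2 U oU [z0 [Uz0 z01]].
have [K [F [e [e0 FU]]]] := weakly_open_sub_weak_ball oU Uz0.
have e20 : 0 < e / 2 by rewrite divr_gt0.
have [z zF z1] := weak_ball_sphere F (X2 i0) e20 z01.
apply: (diam_eq2P _).2 => [|d d0 d1]; first exact: subIsetr.
pose G i k := dual_lp_embed (F k) i.
have [|s [t [a [b [te aP bP ab]]]]] := @lp_replace_spread
    (fun t i => weak_ball (G i) (z i) t) z d _
    (fun t i t0 t1 => diameter2_sphere (G i) (z i) (X2 i) t0 t1) d0 d1 _ e20.
  by rewrite z1; lra.
suff in_U c : (forall i, `|c i| <= `|z i| /\ weak_ball (G i) (z i) t (c i)) ->
    (U `&` unit_ball Z) (lp_replace s c z).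
  by exists (lp_replace s a z), (lp_replace s b z); split => //; exact: in_U.
move=> cP; split; last first.
  by rewrite /unit_ball/= -z1; apply: lp_replace_norm => i; exact: (cP i).1.
apply: FU => k; rewrite dual_lp_replace addrAC.
apply: le_lt_trans (ler_normD _ _) _.
have : `|\sum_(i <- s) (G i k (c i) - G i k (z i))| <= e / 2.
  apply: le_trans (ler_norm_sum _ _ _) _; apply: le_trans te.
  by apply: ler_sum => i _; apply/ltW/(cP i).2.
by have := zF k; rewrite /G; lra.
Qed.

Lemma local_diameter2_lp_sum :
  (forall i, local_diameter2 (X i)) -> local_diameter2 Z.
Proof.
move=> X2 f e f1 e0; have e20 : 0 < e / 2 by rewrite divr_gt0.
apply: (diam_eq2P _).2 => [x [] //|d d0 d1].
(* The first bound leaves room [e / 2] inside the slice for the replacement errors; the second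
   forces [|z| > 1 - d / 4], as [f] has norm 1. *)
pose r := Num.max (1 - e / 2) (1 - d / 4).
have re : 1 - e / 2 <= r by rewrite le_max lexx.
have rd : 1 - d / 4 <= r by rewrite le_max lexx orbT.
have [z zB zr] : exists2 z : Z, unit_ball Z z & r < f z.
  have : (r%:E < dual_norm f)%E by rewrite f1 lte_fin gt_max; lra.
  move=> /ereal_sup_gt[_ [x xB <-]]; rewrite lte_fin.
  (* The dual norm is a supremum of absolute values, so the sign of [x] may have to be changed. *)
  have [fx|fx] := ger0P (f x); first by exists x.
  by exists (- x); rewrite ?/unit_ball/= ?normrN// -scaleN1r dualZ mulN1r.
have dz : 1 - d / 4 < `|z|.
  have : forall x, `|f x| <= 1 * `|x| by apply/dual_norm_le => //; rewrite f1.
  by move=> /(_ z); have := ler_norm (f z); lra.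
pose g i := dual_lp_embed f i.
have [s [t [a [b [te aP bP ab]]]]] := @lp_replace_spread
  (fun t i => [set x | g i (z i) - t < g i x]) z d _
  (fun t i t0 t1 => local_diameter2_sphere (g i) (z i) (X2 i) t0 t1) d0 d1 dz e20.
suff in_slice c : (forall i, `|c i| <= `|z i| /\ g i (z i) - t < g i (c i)) ->
    slice f e (lp_replace s c z).
  by exists (lp_replace s a z), (lp_replace s b z); split => //; exact: in_slice.
move=> cP; split.
  by apply: le_trans zB; apply: lp_replace_norm => i; exact: (cP i).1.
rewrite dual_lp_replace.
suff : - (e / 2) <= \sum_(i <- s) (g i (c i) - g i (z i)) by rewrite /g; lra.
rewrite lerNl -sumrN; apply: le_trans te.
by apply: ler_sum => i _; have := (cP i).2; lra.
Qed.

End diameter2_lp_sum.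

Theorem theorem3p2 (R : realType) (p : \bar R) (p1 : (1 <= p)%E)
    (I : choiceType) (I0 : [set: I] !=set0) (X : I -> completeNormedModType R) :
  ((forall i, diameter2 (X i)) -> diameter2 (lp_sum X p1)) /\
  ((forall i, local_diameter2 (X i)) -> local_diameter2 (lp_sum X p1)).
Proof.
split; first exact: diameter2_lp_sum.
exact: local_diameter2_lp_sum.
Qed.
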